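(* Let $N$ be a nonnegative integer and let $\{\pi(i);\, i\in\mathbb{Z}_N\}$ be a probability distribution on $\mathbb{Z}_N=\{0,1,\dots,N\}$ with $\min_{i\in\mathbb{Z}_N}\pi(i)>0$. Then the FBS (forward binary sampling) procedure generates samples following the target distribution $\{\pi(i);\, i\in\mathbb{Z}_N\}$; that is, its output $i_\ast$ satisfies $\mathsf{P}(i_\ast=i)=\pi(i)$ for every $i\in\mathbb{Z}_N$.
   Context: Setting. $\mathbb{Z}_m=\{0,1,\dots,m\}$ and $\mathbb{B}=\{0,1\}$. Let $d=\lceil\log_2(N+1)\rceil$, i.e. $2^{d-1}<N+1\le 2^d$, and set $\pi(i)=0$ for $i=N+1,\dots,2^d-1$. Write $\boldsymbol{n}^{(0)}=\varnothing$ (the empty vector) and $\boldsymbol{n}^{(\ell)}=(n_1,\dots,n_\ell)\in\mathbb{B}^\ell$; $(\boldsymbol{n}^{(\ell)},b)$ denotes the vector $\boldsymbol{n}^{(\ell)}$ with $b$ appended. Let $\sigma_\ell(\boldsymbol{n}^{(\ell)})=\sum_{j=1}^{\ell}n_j2^{j-1}$ (an empty sum is $0$). Define $\varpi_d(\boldsymbol{n}^{(d)})=\pi(\sigma_d(\boldsymbol{n}^{(d)}))$ for $\boldsymbol{n}^{(d)}\in\mathbb{B}^d$ and recursively, for $\ell=d-1,d-2,\dots,0$, $\varpi_\ell(\boldsymbol{n}^{(\ell)})=\varpi_{\ell+1}(\boldsymbol{n}^{(\ell)},0)+\varpi_{\ell+1}(\boldsymbol{n}^{(\ell)},1)$ for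 $\boldsymbol{n}^{(\ell)}\in\mathbb{B}^\ell$. Let $\mathbb{B}_+^{(d)}=\{\boldsymbol{n}^{(d)}\in\mathbb{B}^d:\sigma_d(\boldsymbol{n}^{(d)})\in\mathbb{Z}_N\}$ and, for $0\le\ell\le d-1$, let $\mathbb{B}_+^{(\ell)}$ be the set of $\boldsymbol{n}^{(\ell)}\in\mathbb{B}^\ell$ such that $(\boldsymbol{n}^{(\ell)},n_{\ell+1},\dots,n_d)\in\mathbb{B}_+^{(d)}$ for some $n_{\ell+1},\dots,n_d\in\mathbb{B}$ (so $\mathbb{B}_+^{(0)}$ consists of the empty vector only). For $0\le\ell\le d-1$ and $\boldsymbol{n}^{(\ell)}\in\mathbb{B}_+^{(\ell)}$ (for which $\varpi_\ell(\boldsymbol{n}^{(\ell)})>0$), let $$\rho_\ell(\boldsymbol{n}^{(\ell)})=\frac{\varpi_{\ell+1}(\boldsymbol{n}^{(\ell)},1)}{\varpi_{\ell+1}(\boldsymbol{n}^{(\ell)},0)+\varpi_{\ell+1}(\boldsymbol{n}^{(\ell)},1)},\qquad \overline{\rho}_\ell(\boldsymbol{n}^{(\ell)})=1-\rho_\ell(\boldsymbol{n}^{(\ell)}).$$ FBS procedure. Input: the values $\varpi_\ell(\boldsymbol{n}^{(\ell)})$, $\ell=1,\dots,d$, $\boldsymbol{n}^{(\ell)}\in\mathbb{B}_+^{(\ell)}$. Step (i): for $\ell=1,2,\dots,d$ in this order, given the already chosen $\boldsymbol{n}^{(\ell-1)}=(n_1,\dots,n_{\ell-1})$, choose $n_\ell\in\mathbb{B}$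 randomly so that, conditionally on $\boldsymbol{n}^{(\ell-1)}$, $n_\ell=1$ with probability $\rho_{\ell-1}(\boldsymbol{n}^{(\ell-1)})$ and $n_\ell=0$ with probability $\overline{\rho}_{\ell-1}(\boldsymbol{n}^{(\ell-1)})$ (a value of probability zero is never chosen). Step (ii): return $i_\ast=\sigma_d(\boldsymbol{n}^{(d)})$. *)

(* Defs.v *)
From HB Require Import structures.
From mathcomp Require Import all_boot all_order all_algebra.
From mathcomp Require Import all_classical all_reals all_analysis.

Set Implicit Arguments.
Unset Strict Implicit.
Unset Printing Implicit Defensive.
Import Order.TTheory GRing.Theory Num.Theory.
Import numFieldNormedType.Exports.
Local Open Scope classical_set_scope.
Local Open Scope ring_scope.

(* Z_N = {0, ..., N} is 'I_N.+1, and B^l is l.-tuple bool (true = 1), the bit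
   n_j being stored at position j - 1. *)

(* up_log 2 m is the least e with m <= 2 ^ e, i.e. the ceiling of log2 m *)
Definition depth (N : nat) : nat := up_log 2 N.+1.

Definition sigma (s : seq bool) : nat :=
  (\sum_(j < size s) nth false s j * 2 ^ j)%N.

Definition is_distribution (R : realType) (N : nat) (pi : 'I_N.+1 -> R) : Prop :=
  (forall i, 0 <= pi i) /\ \sum_i pi i = 1.

Definition extend0 (R : realType) (N : nat) (pi : 'I_N.+1 -> R) (i : nat) : R :=
  if insub i is Some j then pi j else 0.

(* varpi_rec pi k v is varpi_l(v) for the level l = d - k *)
Fixpoint varpi_rec (R : realType) (N : nat) (pi : 'I_N.+1 -> R)
    (k l : nat) (v : l.-tuple bool) : R :=
  if k is k'.+1 then
    varpi_rec pi k' [tuple of rcons v false] +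
    varpi_rec pi k' [tuple of rcons v true]
  else extend0 pi (sigma v).

Definition varpi (R : realType) (N : nat) (pi : 'I_N.+1 -> R)
    (l : nat) (v : l.-tuple bool) : R :=
  varpi_rec pi (depth N - l) v.

(* The set B_+^(l); for l = d the completion w is empty. *)
Definition Bplus (N l : nat) (v : l.-tuple bool) : bool :=
  [exists w : (depth N - l).-tuple bool, (sigma (v ++ w) <= N)%N].

Definition rho (R : realType) (N : nat) (pi : 'I_N.+1 -> R)
    (l : nat) (v : l.-tuple bool) : R :=
  varpi pi [tuple of rcons v true] /
  (varpi pi [tuple of rcons v false] + varpi pi [tuple of rcons v true]).

Definition rhobar (R : realType) (N : nat) (pi : 'I_N.+1 -> R)
    (l : nat) (v : l.-tuple bool) : R := 1 - rho pi v.

(* P(A | B), meaningful when P(B) > 0 *)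
Definition cond_prob d (T : measurableType d) (R : realType)
    (P : probability T R) (A B : set T) : R :=
  fine (P (A `&` B)) / fine (P B).

(* The random vector (n_1, ..., n_l), where n j is the random bit n_(j+1). *)
Definition bits d (T : measurableType d) (R : realType) (P : probability T R)
    (m : nat) (n : 'I_m -> {RV P >-> bool}) (l : nat) (le_lm : (l <= m)%N)
    (t : T) : l.-tuple bool :=
  [tuple n (widen_ord le_lm j) t | j < l].

Definition history d (T : measurableType d) (R : realType) (P : probability T R)
    (m : nat) (n : 'I_m -> {RV P >-> bool}) (l : 'I_m) : T -> l.-tuple bool :=
  bits n (ltnW (ltn_ord l)).

(* Forward binary sampling (FBS): the bits n_1, ..., n_d, random variables on an
   arbitrary probability space, are drawn one after the other, n_(l+1) (that is,
   n l for l = 0, ..., d - 1) being 1 with probability rho_l(n^(l)) and 0 with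
   probability rhobar_l(n^(l)), conditionally on n^(l). *)
Record FBS_run d (T : measurableType d) (R : realType) (P : probability T R)
    (N : nat) (pi : 'I_N.+1 -> R) (n : 'I_(depth N) -> {RV P >-> bool}) : Prop :=
  { FBS_one : forall (l : 'I_(depth N)) (v : l.-tuple bool),
      Bplus N v -> (0 < P [set t | history n l t = v])%E ->
      cond_prob P [set t | n l t = true] [set t | history n l t = v]
        = rho pi v;
    FBS_zero : forall (l : 'I_(depth N)) (v : l.-tuple bool),
      Bplus N v -> (0 < P [set t | history n l t = v])%E ->
      cond_prob P [set t | n l t = false] [set t | history n l t = v]
        = rhobar pi v;
    (* a value of probability zero is never chosen *)
    FBS_never_one : forall (l : 'I_(depth N)) (t : T),
      rho pi (history n l t) = 0 -> n l t = false;
    FBS_never_zero : forall (l : 'I_(depth N)) (t : T),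
      rhobar pi (history n l t) = 0 -> n l t = true }.

Definition FBS_output d (T : measurableType d) (R : realType)
    (P : probability T R) (N : nat) (n : 'I_(depth N) -> {RV P >-> bool})
    (t : T) : nat :=
  sigma (bits n (leqnn (depth N)) t).

(* Main.v *)
Require Import Defs.
From HB Require Import structures.
From mathcomp Require Import all_boot all_order all_algebra.
From mathcomp Require Import all_classical all_reals all_analysis.
Import Order.TTheory GRing.Theory Num.Theory.
Import numFieldNormedType.Exports.
Local Open Scope classical_set_scope.
Local Open Scope ring_scope.

Set Implicit Arguments.
Unset Strict Implicit.
Unset Printing Implicit Defensive.

(** The numbers [varpi] are the marginal laws of the successive bit vectors:
    by induction on [l], the event that the first [l] bits are [v] has
    probability [varpi pi v], for every [v] ([bits_law]). Indeed [varpi] of the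
    empty vector is the total mass 1 of [pi] ([varpi_nil]), and one step of the
    procedure multiplies the probability [varpi pi u] of a prefix [u] by
    [rho pi u] or [rhobar pi u], whose denominator is [varpi pi u]
    ([varpi_split]); so exactly [varpi] of the extended vector is left. The
    conditional probabilities are prescribed only on prefixes of positive
    probability lying in [Bplus]; the former have [varpi pi u > 0], and
    therefore lie in [Bplus] ([Bplus_varpi]), while below a prefix of
    probability zero both sides vanish.

    At [l = depth N], [varpi pi v] is [pi] at [sigma v], and every [i <= N] is
    [sigma v] for a unique [v], because binary expansions of a fixed length
    exist and are unique ([sigma_surj], [sigma_inj]). *)

(** * Binary expansions *)

Lemma sigma_nil : sigma [::] = 0%N.
Proof. by rewrite /sigma big_ord0. Qed.

Lemma sigma_cons b s : sigma (b :: s) = (b + (sigma s).*2)%N.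
Proof.
rewrite /sigma /= big_ord_recl /= muln1; congr addn.
rewrite -muln2 big_distrl /=; apply: eq_bigr => j _.
by rewrite /bump /= add1n expnSr mulnA.
Qed.

Lemma sigma_rcons s b : sigma (rcons s b) = (sigma s + b * 2 ^ size s)%N.
Proof.
elim: s => [|a s IH] /=; first by rewrite sigma_cons sigma_nil expn0 addn0 muln1.
by rewrite !sigma_cons IH doubleD addnA expnSr mulnA muln2.
Qed.

Lemma sigma_inj s1 s2 : size s1 = size s2 -> sigma s1 = sigma s2 -> s1 = s2.
Proof.
elim: s1 s2 => [|a s1 IH] [|b s2] //= [Hs]; rewrite !sigma_cons => H.
have eab : a = b.
  by move: (congr1 odd H); rewrite !oddD !odd_double !addbF !oddb.
subst b; congr cons; apply: IH => //.
by move/addnI: H => /double_inj.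
Qed.

Lemma sigma_surj k i : (i < 2 ^ k)%N -> exists v : k.-tuple bool, sigma v = i.
Proof.
elim: k i => [|k IH] i Hi.
  by exists [tuple]; rewrite sigma_nil; case: i Hi.
have [|v Hv] := IH i./2.
  by rewrite ltn_half_double -mul2n -expnS.
by exists [tuple of odd i :: v]; rewrite sigma_cons Hv odd_double_half.
Qed.

Lemma tuple_rconsP (A : Type) l (v : l.+1.-tuple A) :
  exists (u : l.-tuple A) b, v = [tuple of rcons u b].
Proof.
case: v => s; case/lastP: s => [//|s b] Hs.
have Hu : size s == l by move: Hs; rewrite size_rcons eqSS.
by exists (Tuple Hu), b; apply: val_inj.
Qed.

(** * Subtree sums of the target distribution *)

Lemma sum_even_odd (V : nmodType) (F : nat -> V) m :
  \sum_(j < m.*2) F j = \sum_(j < m) F j.*2 + \sum_(j < m) F j.*2.+1.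
Proof.
elim: m => [|m IH]; first by rewrite !big_ord0 addr0.
by rewrite doubleS !big_ord_recr /= IH -!addrA; congr +%R; rewrite addrCA.
Qed.

Section Varpi.
Variables (R : realType) (N : nat) (pi : 'I_N.+1 -> R).

Lemma extend0_ord (i : 'I_N.+1) : extend0 pi i = pi i.
Proof. by rewrite /extend0 valK. Qed.

Lemma extend0_out i : (N < i)%N -> extend0 pi i = 0.
Proof. by move=> Hi; rewrite /extend0 insubF // ltnS leqNgt Hi. Qed.

(** [v] fixes the [l] low-order bits, so its completions by [k] more bits are
    the numbers below [2 ^ (l + k)] congruent to [sigma v] modulo [2 ^ l]. *)
Lemma varpi_recE k l (v : l.-tuple bool) :
  varpi_rec pi k v = \sum_(j < 2 ^ k) extend0 pi (sigma v + j * 2 ^ l)%N.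
Proof.
elim: k l v => [|k IH] l v /=.
  by rewrite big_ord1 mul0n addn0.
rewrite !IH !sigma_rcons size_tuple [in RHS]expnS [in RHS]mul2n.
rewrite (sum_even_odd (fun j => extend0 pi (sigma v + j * 2 ^ l)%N)).
congr +%R; apply: eq_bigr => j _; congr (extend0 pi _);
  by rewrite -addnA; congr (_ + _)%N; rewrite expnS mulnA muln2 -mulnDl.
Qed.

(** Indices [N < i < 2 ^ depth N] carry no mass. *)
Lemma varpi_nil : varpi pi [tuple] = \sum_i pi i.
Proof.
rewrite /varpi varpi_recE subn0 sigma_nil.
under eq_bigr do rewrite add0n muln1.
have le_N : (N.+1 <= 2 ^ depth N)%N by exact: up_logP.
rewrite -(big_mkord xpredT (extend0 pi)) (big_cat_nat (leq0n _) le_N) //=.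
rewrite [X in _ + X]big1_seq ?addr0 => [|i]; last first.
  by rewrite mem_index_iota => /andP[_ /andP[/extend0_out]].
by rewrite big_mkord; apply: eq_bigr => i _; rewrite extend0_ord.
Qed.

Lemma varpi_leaf (v : (depth N).-tuple bool) (i : 'I_N.+1) :
  sigma v = i -> varpi pi v = pi i.
Proof. by move=> vi; rewrite /varpi subnn /= vi extend0_ord. Qed.

Lemma varpi_split l (v : l.-tuple bool) : (l < depth N)%N ->
  varpi pi v =
    varpi pi [tuple of rcons v false] + varpi pi [tuple of rcons v true].
Proof. by move=> lt_l; rewrite /varpi -subnSK. Qed.

Lemma Bplus_varpi l (v : l.-tuple bool) : varpi pi v != 0 -> Bplus N v.
Proof.
rewrite /varpi /Bplus; move: (depth N - l)%N => k.
elim: k l v => [|k IH] l v /= nz.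
  apply/existsP; exists [tuple]; rewrite /= cats0 leqNgt.
  by apply: contra_neqN nz => /extend0_out.
have [b nzb] : exists b, varpi_rec pi k [tuple of rcons v b] != 0.
  case: (eqVneq (varpi_rec pi k [tuple of rcons v false]) 0) => [e0|].
    by exists true; move: nz; rewrite e0 add0r.
  by exists false.
have /existsP[w Hw] := IH _ _ nzb.
by apply/existsP; exists [tuple of b :: w]; move: Hw; rewrite /= cat_rcons.
Qed.

Hypothesis pi_ge0 : forall i, 0 <= pi i.

Lemma varpi_ge0 l (v : l.-tuple bool) : 0 <= varpi pi v.
Proof.
rewrite /varpi varpi_recE; apply: sumr_ge0 => j _.
by rewrite /extend0; case: insubP.
Qed.

Lemma varpi_rcons_eq0 l (v : l.-tuple bool) b : (l < depth N)%N ->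
  varpi pi v = 0 -> varpi pi [tuple of rcons v b] = 0.
Proof.
move=> lt_l /eqP; rewrite varpi_split // paddr_eq0 ?varpi_ge0 //.
by case: b => /andP[/eqP e0 /eqP e1].
Qed.

End Varpi.

(** * The law of the bits *)

Section Bits.
Variables (R : realType) (d : measure_display) (T : measurableType d).
Variables (P : probability T R) (m : nat) (n : 'I_m -> {RV P >-> bool}).

Lemma bits0 (le_lm : (0 <= m)%N) (v : 0.-tuple bool) :
  [set t | bits n le_lm t = v] = setT.
Proof. by apply/seteqP; split => // t _ /=; rewrite [v]tuple0 [LHS]tuple0. Qed.

Lemma bits_rcons l (lt_lm : (l < m)%N) (u : l.-tuple bool) b :
  [set t | bits n lt_lm t = [tuple of rcons u b]] =
  [set t | n (Ordinal lt_lm) t = b] `&` [set t | bits n (ltnW lt_lm) t = u].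
Proof.
have bitsS t : bits n lt_lm t =
    [tuple of rcons (bits n (ltnW lt_lm) t) (n (Ordinal lt_lm) t)].
  apply: val_inj; rewrite /= enum_ordSr map_rcons -map_comp.
  congr rcons; last by congr (n _ t); apply: val_inj.
  by apply: eq_map => j /=; congr (n _ t); apply: val_inj.
apply/seteqP; split => t /=; rewrite bitsS.
  by move/(congr1 val) => /= /rcons_inj[eu ->]; split=> //; apply: val_inj.
by case=> -> ->.
Qed.

Lemma measurable_bit_eq (j : 'I_m) b : measurable [set t | n j t = b].
Proof. by apply: (measurable_funPTI (n j) (Y := [set b])). Qed.

Lemma measurable_bits_eq l (le_lm : (l <= m)%N) (v : l.-tuple bool) :
  measurable [set t | bits n le_lm t = v].
Proof.
elim: l le_lm v => [|l IH] le_lm v; first by rewrite bits0.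
have [u [b ->]] := tuple_rconsP v.
by rewrite bits_rcons; apply: measurableI => //; exact: measurable_bit_eq.
Qed.

End Bits.

Lemma cond_probM (R : realType) (d : measure_display) (T : measurableType d)
    (P : probability T R) (A B : set T) (x : R) :
    measurable A -> measurable B -> x != 0 -> P B = x%:E ->
  P (A `&` B) = (cond_prob P A B * x)%:E.
Proof.
move=> mA mB x0 PB; rewrite /cond_prob PB /= divfK // fineK //.
by apply: fin_num_measure; exact: measurableI.
Qed.

Section Law.
Variables (R : realType) (N : nat) (pi : 'I_N.+1 -> R).
Hypothesis pi_distr : is_distribution pi.
Variables (d : measure_display) (T : measurableType d) (P : probability T R).
Variable n : 'I_(depth N) -> {RV P >-> bool}.
Hypothesis n_run : FBS_run pi n.

(** Both branches of the procedure in one formula: by [varpi_split] the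
    denominator of [rho] is [varpi pi u], so [rhobar pi u] is the share of the
    other child. *)
Lemma FBS_step (l : 'I_(depth N)) (u : l.-tuple bool) b :
    varpi pi u != 0 -> (0 < P [set t | history n l t = u])%E ->
  cond_prob P [set t | n l t = b] [set t | history n l t = u] =
    varpi pi [tuple of rcons u b] / varpi pi u.
Proof.
move=> nz Pu; have Bu := Bplus_varpi nz.
rewrite (varpi_split pi u (ltn_ord l)) in nz *.
case: b; first exact: (FBS_one n_run).
rewrite (FBS_zero n_run) // /rhobar /rho.
by rewrite -{1}(divff nz) -mulrBl addrK.
Qed.

Lemma bits_law l (le_l : (l <= depth N)%N) (v : l.-tuple bool) :
  P [set t | bits n le_l t = v] = (varpi pi v)%:E.
Proof.
have [pi_ge0 pi_sum1] := pi_distr.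
elim: l le_l v => [|l IH] lt_l v.
  by rewrite bits0 probability_setT [v]tuple0 varpi_nil pi_sum1.
have [u [b ->]] := tuple_rconsP v; rewrite bits_rcons.
pose lo := Ordinal lt_l.
(* [history n lo] is [bits n] with another proof of [l <= depth N]. *)
have eqh : [set t | bits n (ltnW lt_l) t = u] = [set t | history n lo t = u].
  by rewrite /history (bool_irrelevance (ltnW (ltn_ord lo)) (ltnW lt_l)).
have mA := measurable_bit_eq n lo b.
have mB := measurable_bits_eq n (ltnW lt_l) u.
have PB := IH (ltnW lt_l) u.
case: (eqVneq (varpi pi u) 0) => [u0|nz].
  rewrite (varpi_rcons_eq0 pi_ge0) //; apply/eqP.
  rewrite eq_le measure_ge0 andbT.
  rewrite -u0 -PB; apply: le_measure; rewrite ?inE //; exact: measurableI.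
rewrite (cond_probM mA mB nz PB) eqh FBS_step ?divfK // -eqh PB lte_fin.
by rewrite lt_def nz varpi_ge0.
Qed.

End Law.

Theorem theorem3p1 (R : realType) (N : nat) (pi : 'I_N.+1 -> R)
    (pi_distr : is_distribution pi) (pi_gt0 : forall i, 0 < pi i)
    (d : measure_display) (T : measurableType d) (P : probability T R)
    (n : 'I_(depth N) -> {RV P >-> bool}) (n_run : FBS_run pi n) :
  forall i : 'I_N.+1, P [set t | FBS_output n t = i] = (pi i)%:E.
Proof.
move=> i.
have [v vi] : exists v : (depth N).-tuple bool, sigma v = i.
  by apply: sigma_surj; apply: leq_trans (ltn_ord i) _; exact: up_logP.
rewrite -(varpi_leaf pi vi) -(bits_law pi_distr n_run (leqnn _) v).
congr (P _); apply/seteqP; split => t /=; rewrite /FBS_output -vi; last by move->.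
by move=> e; apply: val_inj; apply: sigma_inj e; rewrite !size_tuple.
Qed.
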